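(* For all integers $r\geq 2$ and $m,j\geq 0$, we have $$|\mathcal{O}_{j,r}(m)|=|\mathcal{D}_{j,r}(m)|.$$
   Context: A colored part is a symbol $n_i$ with $n,i$ integers and $1\le i\le n$; $n$ is called its size and $i$ its subscript (or color). Two colored parts $n_i$ and $n'_{i'}$ are equal if and only if $n=n'$ and $i=i'$. An $n$-color partition of a non-negative integer $m$ is a finite multiset of colored parts whose sizes (counted with multiplicity) sum to $m$; the only $n$-color partition of $0$ is the empty one. The multiplicity of a colored part in an $n$-color partition is the number of times it occurs in it. For example, the six $n$-color partitions of $3$ are $(1_1,1_1,1_1)$, $(2_1,1_1)$, $(2_2,1_1)$, $(3_1)$, $(3_2)$, $(3_3)$. For integers $r\ge 2$ and $j,m\ge 0$: - $\mathcal{O}_{j,r}(m)$ is the set of $n$-color partitions of $m$ with exactly $j$ different colored parts (counted without multiplicity; each may be repeated) whose size and subscript are both divisible by $r$. - $\mathcal{D}_{j,r}(m)$ is the set of $n$-color partitions of $m$ with exactly $j$ different colored parts (counted without multiplicity) that occur with multiplicity at least $r$. *)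

(* Defs.v *)
From HB Require Import structures.
From mathcomp Require Import all_boot finmap multiset.
From mathcomp Require Import boolp classical_sets functions cardinality.

Set Implicit Arguments.
Unset Strict Implicit.
Unset Printing Implicit Defensive.

Local Open Scope nat_scope.
Local Open Scope fset_scope.
Local Open Scope mset_scope.
Local Open Scope classical_set_scope.

(* The colored part n_i is encoded by the pair (n, i). *)
Record colored_part := ColoredPart {
  cpair : nat * nat;
  cpairP : 1 <= cpair.2 <= cpair.1
}.

HB.instance Definition _ := [isSub for cpair].
HB.instance Definition _ := [Countable of colored_part by <:].

Definition psize (c : colored_part) : nat := (cpair c).1.
Definition subscript (c : colored_part) : nat := (cpair c).2.

(* For P : {mset colored_part}, P c is the multiplicity of c in P, finsupp P
   is the finite set of the different colored parts of P, and a sum over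
   c <- P counts every c with its multiplicity. *)
Definition ncolor_partition (m : nat) : set {mset colored_part} :=
  [set P : {mset colored_part} | \sum_(c <- P) psize c = m].

Definition O_set (j r m : nat) : set {mset colored_part} :=
  [set P : {mset colored_part} | ncolor_partition m P /\
    #|` [fset c in finsupp P | (r %| psize c) && (r %| subscript c)]| = j].

Definition D_set (j r m : nat) : set {mset colored_part} :=
  [set P : {mset colored_part} | ncolor_partition m P /\
    #|` [fset c in finsupp P | r <= P c]| = j].

(* Main.v *)
Require Import Defs.
From mathcomp Require Import all_boot finmap multiset.
From mathcomp Require Import boolp classical_sets functions cardinality.
Local Open Scope fset_scope.
Local Open Scope mset_scope.
Local Open Scope nat_scope.

(** The proof is an explicit bijection [glaisher] from all n-color partitions to
    all n-color partitions; it preserves the sum of the sizes and turns the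
    parts with size and subscript divisible by [r] into the parts of
    multiplicity at least [r].

    Write [r c] for [scale c], the part [c] with size and subscript multiplied
    by [r].  The divisible parts are exactly the parts [r c], and every part is
    [r^k c] for a unique [k] and a unique non-divisible [c] ([scaleP],
    [iter_scale_eq]).  A partition [N] is sent to the sum over its distinct
    parts of the following contributions.
    - [n] copies of a divisible part [r c] become [r * n] copies of [c].
    - [n] copies of a non-divisible part [c] are split as in Glaisher's
      bijection: with [n] written in base [r], the digit of [r^k] is the number
      of copies of [r^k c].
    Both replacements keep the total size.  Hence ([glaisherE]) the multiplicity
    of [d = r^k c] in the image is [r * N (r d)] plus the [k]-th digit of [N c].
    As a digit is less than [r], this is a Euclidean division: the
    quotient gives the multiplicities of the divisible parts of [N], and it is
    positive exactly when [r d] occurs in [N] ([repeated_glaisher]); the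
    remainders give the digits of the other multiplicities.  So [N] can be
    recovered, and any choice of quotients and remainders with finite support
    is reached ([glaisher_inj], [glaisher_surj]). *)

Set Implicit Arguments.
Unset Strict Implicit.
Unset Printing Implicit Defensive.

(** * Multisets with prescribed multiplicities *)

Lemma mset_of_fun (T : choiceType) (f : T -> nat) (s : seq T) :
  (forall x, f x != 0 -> x \in s) -> exists N : {mset T}, N =1 f.
Proof.
move=> f_supp; exists [fsfun x in [fset x in s] => f x] => x.
rewrite fsfunE inE /=; case: ifPn => // xs; apply/esym/eqP.
by apply: contraNT xs; apply: f_supp.
Qed.

Section Glaisher.
Variables (r : nat) (r_gt1 : 1 < r).

Let r_gt0 : 0 < r. Proof. exact: ltnW. Qed.

(** * Digits in base r *)

Definition digit (n k : nat) : nat := n %/ r ^ k %% r.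

Lemma digit_lt n k : digit n k < r.
Proof. by rewrite ltn_mod. Qed.

Lemma ltn_exp_base n k : n <= k -> n < r ^ k.
Proof. by move=> le_nk; apply: leq_ltn_trans le_nk _; apply: ltn_expl. Qed.

Lemma digit_small n k : n <= k -> digit n k = 0.
Proof.
by move=> le_nk; rewrite /digit (divn_small (ltn_exp_base le_nk)) mod0n.
Qed.

Lemma sum_digit_mod K n : \sum_(k < K) digit n k * r ^ k = n %% r ^ K.
Proof.
elim: K => [|K IHK]; first by rewrite big_ord0 expn0 modn1.
rewrite big_ord_recr /= IHK /digit modn_divl -expnS addnC.
by rewrite -(modn_dvdm n (dvdn_exp2l r (leqnSn K))) -divn_eq.
Qed.

Lemma sum_digit K n : n <= K -> \sum_(k < K) digit n k * r ^ k = n.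
Proof.
by move=> le_nK; rewrite sum_digit_mod (modn_small (ltn_exp_base le_nK)).
Qed.

Lemma digit_inj n n' : (forall k, digit n k = digit n' k) -> n = n'.
Proof.
move=> eq_d; rewrite -[LHS](sum_digit (leq_addr n' n)) -[RHS](sum_digit (leq_addl n n')).
by apply: eq_bigr => k _; rewrite eq_d.
Qed.

(** Digits may be prescribed freely: this is what makes [glaisher_surj] work. *)
Lemma digit_sum (s : nat -> nat) K i : (forall k, s k < r) ->
  digit (\sum_(k < K) s k * r ^ k) i = if i < K then s i else 0.
Proof.
move=> s_lt; elim: K s s_lt i => [|K IHK] s s_lt i.
  by rewrite big_ord0 /digit div0n mod0n.
rewrite big_ord_recl expn0 muln1 /=.
under eq_bigr => k _ do rewrite /bump /= add1n expnSr mulnA.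
rewrite -big_distrl /=; case: i => [|i].
  by rewrite /digit expn0 divn1 addnC modnMDl modn_small.
rewrite ltnS -(IHK (fun k => s k.+1)) // /digit expnS divnMA.
by rewrite addnC divnMDl // (divn_small (s_lt 0)) addn0.
Qed.

(** * Scaling of colored parts *)

Definition divisible (c : colored_part) : bool :=
  (r %| psize c) && (r %| subscript c).

Lemma scale_subproof c : 1 <= r * subscript c <= r * psize c.
Proof. by case/andP: (cpairP c) => ? ?; rewrite muln_gt0 r_gt0 leq_pmul2l //; apply/andP. Qed.

Definition scale (c : colored_part) : colored_part :=
  @ColoredPart (r * psize c, r * subscript c) (scale_subproof c).

(** A meaningful inverse of [scale] only on divisible parts. *)
Definition unscale (c : colored_part) : colored_part :=
  insubd c (psize c %/ r, subscript c %/ r).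

Lemma psize_gt0 c : 0 < psize c.
Proof. by case/andP: (cpairP c) => /leq_trans h /h. Qed.

Lemma divisible_scale c : divisible (scale c).
Proof. by rewrite /divisible !dvdn_mulr. Qed.

Lemma scaleK : cancel scale unscale.
Proof.
move=> c; apply: val_inj; rewrite val_insubd /psize /subscript /= !mulKn //.
by rewrite (cpairP c) -surjective_pairing.
Qed.

Lemma scale_inj : injective scale. Proof. exact: can_inj scaleK. Qed.

Lemma unscaleK c : divisible c -> scale (unscale c) = c.
Proof.
case/andP=> rn ri; have /andP[i_gt0 le_in] := cpairP c.
have P : 1 <= subscript c %/ r <= psize c %/ r.
  by rewrite divn_gt0 // dvdn_leq //= leq_div2r.
apply: val_inj; rewrite /= /psize /subscript.
have -> : cpair (unscale c) = (psize c %/ r, subscript c %/ r).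
  by rewrite -[cpair _]/(val _) val_insubd /= P.
by rewrite /= ![r * _]mulnC !divnK // -surjective_pairing.
Qed.

Lemma psize_iter_scale k c : psize (iter k scale c) = r ^ k * psize c.
Proof. by elim: k => [|k IHk]; rewrite ?expn0 ?mul1n //= expnS -mulnA -IHk. Qed.

Lemma iter_scaleK k : cancel (iter k scale) (iter k unscale).
Proof. by elim: k => [|k IHk] c //; rewrite iterSr iterS scaleK. Qed.

(** Stated as a view so that any colored part can be replaced by its
    decomposition; the existence holds because dividing by [r > 1] decreases
    the size and must stop at a non-divisible part. *)
Variant scale_spec : colored_part -> Type :=
  ScaleSpec k c of ~~ divisible c : scale_spec (iter k scale c).

Lemma scaleP d : scale_spec d.
Proof.
have [n] := ubnP (psize d); elim: n d => // n IHn d lt_dn.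
have [dv|ndv] := boolP (divisible d); last exact: (ScaleSpec 0).
rewrite -(unscaleK dv); case: (IHn (unscale d)) => [|k c nc].
  rewrite -ltnS (leq_trans _ lt_dn) // ltnS -[in X in _ < X](unscaleK dv).
  by rewrite -{1}[psize _]mul1n ltn_pmul2r ?psize_gt0.
exact: (ScaleSpec k.+1).
Qed.

(** Uniqueness in [scaleP]: a scaled part is divisible, so the outer scalings on
    both sides can only be cancelled in parallel. *)
Lemma iter_scale_eq k l c d : ~~ divisible c -> ~~ divisible d ->
  (iter k scale c == iter l scale d) = (c == d) && (k == l).
Proof.
move=> nc nd; elim: k l => [|k IHk] [|l].
- by rewrite andbT.
- rewrite andbF; apply/negP=> /eqP /= e.
  by rewrite /= e divisible_scale in nc.
- rewrite andbF; apply/negP=> /eqP /= e.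
  by rewrite /= -e divisible_scale in nd.
- by rewrite !iterS (inj_eq scale_inj) IHk eqSS.
Qed.

(** * The bijection *)

(** What [n] copies of [c] become.  Digits beyond the [n] listed ones vanish,
    because [n < r ^ n]. *)
Definition expand (n : nat) (c : colored_part) : seq colored_part :=
  if divisible c then nseq (r * n) (unscale c)
  else flatten [seq nseq (digit n k) (iter k scale c) | k <- iota 0 n].

(** The weight [F] is [psize] when total sizes are computed and the indicator
    function of a part when multiplicities are computed. *)
Lemma sum_expand (F : colored_part -> nat) n c :
  \sum_(d <- expand n c) F d =
  if divisible c then r * n * F (unscale c)
  else \sum_(k < n) digit n k * F (iter k scale c).
Proof.
have sum_nseq m d : \sum_(e <- nseq m d) F e = m * F d.
  by rewrite big_nseq iter_addn_0 mulnC.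
rewrite /expand; case: ifP => // _.
rewrite big_flatten big_map.
rewrite -(big_mkord xpredT (fun k => digit n k * F (iter k scale c))).
by rewrite /index_iota subn0; apply: eq_bigr => k _; rewrite sum_nseq.
Qed.

Lemma psize_expand n c : \sum_(d <- expand n c) psize d = n * psize c.
Proof.
rewrite sum_expand; case: ifP => [dv|_].
  by rewrite -[in RHS](unscaleK dv) mulnAC mulnC.
under eq_bigr => k _ do rewrite psize_iter_scale mulnA.
by rewrite -big_distrl /= sum_digit.
Qed.

(** A part [r^k c0] arises in two ways only: from [r^(k+1) c0], by removing one
    factor, and from the non-divisible [c0], as a digit. *)
Lemma count_expand n c k c0 : ~~ divisible c0 ->
  count_mem (iter k scale c0) (expand n c) =
  (c == iter k.+1 scale c0) * (r * n) + (c == c0) * digit n k.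
Proof.
move=> nc0; rewrite -sum1_count big_mkcond /=.
rewrite (sum_expand (fun d => if d == iter k scale c0 then 1 else 0)) /=.
case: ifPn => [dv|nc].
  have /negPf-> : c != c0 by apply: contraNneq nc0 => <-.
  rewrite addn0 -[in RHS](unscaleK dv) (inj_eq scale_inj).
  by case: (_ == _); rewrite ?muln0 ?mul0n // muln1 mul1n.
have /negPf-> : c != scale (iter k scale c0).
  by apply: contraNneq nc => ->; apply: divisible_scale.
rewrite mul0n add0n.
under eq_bigr => i _ do rewrite iter_scale_eq //.
case: eqVneq => [_|_] /=; last by rewrite big1 // => i; rewrite muln0.
rewrite mul1n; have [lt_kn|le_nk] := ltnP k n; last first.
  (* the indices below [n] miss [k], and the digit at [k] is zero *)
  rewrite (digit_small le_nk) big1 // => i _.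
  by rewrite ltn_eqF ?muln0 // (leq_trans (ltn_ord i)).
rewrite (bigD1 (Ordinal lt_kn)) //= eqxx muln1 big1 ?addn0 // => i.
by rewrite -val_eqE /= => /negPf->; rewrite muln0.
Qed.

Definition glaisher (N : {mset colored_part}) : {mset colored_part} :=
  seq_mset (flatten [seq expand (N c) c | c <- finsupp N]).

Lemma sum_finsupp_eq (N : {mset colored_part}) a (h : nat -> nat) : h 0 = 0 ->
  \sum_(c <- finsupp N) (c == a) * h (N c) = h (N a).
Proof.
move=> h0; have [aN|aN] := finsuppP N a.
  rewrite h0 big1_seq // => c /andP[_ cN].
  by case: eqP aN cN => [-> /negPf->|].
rewrite (bigD1_seq a) //= eqxx mul1n big1 ?addn0 // => c.
by move=> /negPf->.
Qed.

(** A Euclidean division by [r] of the multiplicities in the image, since the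
    last term is less than [r]; all the properties below are read off it. *)
Lemma glaisherE N k c : ~~ divisible c ->
  glaisher N (iter k scale c) = r * N (iter k.+1 scale c) + digit (N c) k.
Proof.
move=> nc; rewrite mset_seqE count_flatten -map_comp sumn_map.
under eq_bigr => d _ do rewrite /= count_expand //.
rewrite big_split /= (sum_finsupp_eq _ _ (muln0 r)).
by rewrite (@sum_finsupp_eq N c (digit^~ k)) // digit_small.
Qed.

Lemma size_glaisher N :
  \sum_(d <- glaisher N) psize d = \sum_(c <- N) psize c.
Proof.
rewrite [RHS]sum_mset (perm_big _ (perm_eq_seq_mset _)) /= big_flatten big_map.
by apply: eq_bigr => c _; rewrite psize_expand.
Qed.

Lemma repeated_glaisher N d :
  (r <= glaisher N d) = (scale d \in finsupp N).
Proof.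
rewrite mem_finsupp; case: (scaleP d) => k c nc; rewrite glaisherE //=.
have [->|] := eqVneq; first by rewrite muln0 leqNgt ltn_mod r_gt0.
by rewrite -lt0n => N_gt0; rewrite (leq_trans _ (leq_addr _ _)) // leq_pmulr.
Qed.

(** By [repeated_glaisher], [scale] is a bijection between the two sets. *)
Lemma card_repeated_glaisher N :
  #|` [fset d in finsupp (glaisher N) | r <= glaisher N d]%fset| =
  #|` [fset c in finsupp N | (r %| psize c) && (r %| subscript c)]%fset|.
Proof.
set A := (X in #|` X| = _).
have <- : #|` [fset scale d | d in A]%fset| = #|` A|.
  exact: (card_imfset _ _ scale_inj).
apply: (congr1 (fun X : {fset colored_part} => #|` X|)).
apply/fsetP => c; apply/imfsetP/idP => [[d]|].
  rewrite !inE /= => /andP[_]; rewrite repeated_glaisher => dN ->.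
  by rewrite dN; apply: divisible_scale.
rewrite !inE /= => /andP[cN dv]; exists (unscale c); rewrite ?unscaleK //.
have rep : r <= glaisher N (unscale c) by rewrite repeated_glaisher unscaleK.
by rewrite !inE /= rep andbT mem_finsupp -lt0n (leq_trans r_gt0).
Qed.

(** Quotients and remainders modulo [r] of the image determine the divisible
    multiplicities and the digits of the others. *)
Lemma glaisher_inj : injective glaisher.
Proof.
move=> N N' /msetP eqG; apply/msetP => c.
have eqG2 k d : ~~ divisible d -> 
    N (iter k.+1 scale d) = N' (iter k.+1 scale d) /\
    digit (N d) k = digit (N' d) k.
  move=> nd; have := eqG (iter k scale d); rewrite !glaisherE // ![r * _]mulnC.
  move=> e; have := congr1 (divn^~ r) e; have := congr1 (modn^~ r) e.
  by rewrite !modnMDl !divnMDl // !(divn_small, modn_small) ?digit_lt ?addn0.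
case: (scaleP c) => -[|k] d nd; last by case: (eqG2 k d nd).
by apply: digit_inj => k; case: (eqG2 k d nd).
Qed.

Lemma psize_le_sum (P : {mset colored_part}) d :
  0 < P d -> psize d <= \sum_(c <- P) psize c.
Proof.
rewrite lt0n -mem_finsupp => dP.
rewrite sum_mset (bigD1_seq d) //= (leq_trans _ (leq_addr _ _)) //.
by rewrite leq_pmull // lt0n -mem_finsupp.
Qed.

(** The preimage is read off [glaisherE]: the quotients of the multiplicities in
    [P] by [r] are its divisible multiplicities, and the remainders along the
    orbit of [c] under [scale] are the digits of its multiplicity at [c]. *)
Lemma glaisher_surj P : exists N, glaisher N = P.
Proof.
(* A part of [P] has size less than K, and [r^k c] has size at least
   [r ^ k > k]; so the remainders vanish from index K on. *)
pose K := (\sum_(c <- P) psize c).+1.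
have P_big k c : K <= k -> P (iter k scale c) = 0.
  move=> le_Kk; apply/eqP; rewrite -leqn0 leqNgt; apply/negP => /psize_le_sum.
  apply/negP; rewrite -ltnNge -/K psize_iter_scale (leq_trans le_Kk) //.
  by rewrite (leq_trans (ltnW (ltn_exp_base (leqnn k)))) // leq_pmulr ?psize_gt0.
pose f c := if divisible c then P (unscale c) %/ r
            else \sum_(k < K) P (iter k scale c) %% r * r ^ k.
have [|N NE] := @mset_of_fun _ f ([seq scale d | d <- finsupp P] ++
    [seq iter k unscale d | k <- iota 0 K, d <- finsupp P]).
  move=> c; rewrite mem_cat /f; case: ifP => [dv fn0|_ fn0].
    apply/orP; left; rewrite -(unscaleK dv) map_f // mem_finsupp.
    by apply: contraNneq fn0 => ->; rewrite div0n.
  apply/orP; right; have [k Pk] : exists k : 'I_K, P (iter k scale c) != 0.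
    apply/existsP; apply: contraNT fn0; rewrite negb_exists => /forallP P0.
    by rewrite big1 // => k _; move: (P0 k); rewrite negbK => /eqP->; rewrite mod0n.
  apply/allpairsP; exists (val k, iter k scale c).
  by split; rewrite ?mem_iota ?ltn_ord ?mem_finsupp ?iter_scaleK.
exists N; apply/msetP => d; case: (scaleP d) => k c nc.
rewrite glaisherE // !NE /f divisible_scale scaleK (negPf nc).
rewrite (@digit_sum (fun i => P (iter i scale c) %% r)); last first.
  by move=> i; rewrite ltn_mod.
have [lt_kK|/P_big->] := ltnP k K; last by rewrite div0n muln0.
by rewrite mulnC -divn_eq.
Qed.
End Glaisher.

Local Open Scope card_scope.

(* A #= B : the cardinals of A and B are equal. *)
Theorem theorem2p1 (r m j : nat) (hr : (2 <= r)%N) :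
  O_set j r m #= D_set j r m.
Proof.
have -> : D_set j r m = (glaisher hr @` O_set j r m)%classic.
  apply/seteqP; split=> [P [Pm Pj]|_ [N [Nm Nj] <-]].
    have [N GN] := glaisher_surj hr P; exists N => //; subst P.
    by split; [rewrite -Pm /ncolor_partition /= size_glaisher
              | rewrite -card_repeated_glaisher].
  by split; [rewrite /ncolor_partition /= size_glaisher
            | rewrite card_repeated_glaisher].
rewrite card_eq_sym; apply: inj_card_eq => N N' _ _; exact: glaisher_inj.
Qed.
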